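(* Let $\mathsf{TTR}=\langle e_{\mathsf s},\boldsymbol{\alpha_1}:\delta_1,\boldsymbol{\alpha_2}:\delta_2,\dots,\boldsymbol{\alpha_k}:\delta_k\rangle$ be an instance of the Tightly Timed Response problem, and assume that it is solved in $\mathcal R$ (the synchronous full-information system described in the context). Let $r\in\mathcal R$ be a run in which $e_{\mathsf s}$ occurs, and let $A=\{\alpha_1,\dots,\alpha_k\}$ be the set of nodes at which the responses are carried out in $r$ (response $\boldsymbol{\alpha_j}$ occurs at node $\alpha_j=\langle i_j,t_j\rangle$). Let $\alpha_h=\langle i_h,t_h\rangle$ be the earliest node in $A$. Then $$(\mathcal R,r)\vDash C_A\,\mathsf{occurred}_{t_h}(e_{\mathsf s}).$$
   Context: Model. $\mathbb P=\{1,\dots,n\}$ is a finite set of agents; time ranges over $\mathbb N$. A node is a pair $\langle i,t\rangle$ with $i\in\mathbb P$ and $t$ a time. The network is a fixed (commonly known) directed graph on $\mathbb P$ in which each channel $(i,j)$ carries a weight $max_{ij}$ (a positive integer), the upper bound on transmission time. A run $r$ is a function from times to global states; $r_i(t)$ is agent $i$'s local state at time $t$ in $r$. $\mathcal R$ is the set of all runs arising when the agents follow the full-information protocol in the following synchronous environment. (1) The environment nondeterministically chooses, at each time, an arbitrary (possibly empty) set of agents at which external input events occur and which external inputs occur there; this choice is unconstrained by other occurrences. An individual external input event is associated with a specific agent and occurs at a single node, i.e. at most once in a run. (2) Each agent has a fixed initial state and perfect recall: $r_i(t)$ is the complete time-stamped history of $i$ up to and including time $t$, including the external inputs and messages (with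 their senders) received at nodes $\langle i,t'\rangle$ with $t'\le t$. (3) At every node $\langle i,t\rangle$, agent $i$ sends a message containing $r_i(t)$ on every outgoing channel; any further local actions (in particular responses) at $\langle i,t\rangle$ are a deterministic function of $r_i(t)$. (4) A message sent at $\langle i,t\rangle$ on channel $(i,j)$ is delivered at some $\langle j,t'\rangle$ with $t<t'\le t+max_{ij}$; the environment chooses delivery times nondeterministically and arbitrarily within this bound. Semantics. $(\mathcal R,r)\vDash\mathsf{occurred}_t(e)$ iff event $e$ has occurred in $r$ by time $t$. $(\mathcal R,r)\vDash K_{\langle i,t\rangle}\varphi$ iff $(\mathcal R,r')\vDash\varphi$ for all $r'\in\mathcal R$ with $r_i(t)=r'_i(t)$. $(\mathcal R,r)\vDash E_A\varphi$ iff $(\mathcal R,r)\vDash K_\alpha\varphi$ for every $\alpha\in A$. $(\mathcal R,r)\vDash C_A\varphi$ iff $(\mathcal R,r)\vDash (E_A)^m\varphi$ for every $m\ge1$. Responses. A response $\boldsymbol{\alpha_j}$ is a pair $\langle i_j,a_j\rangle$ indicating a (local) action $a_j$ that agent $i_j$ is required to carry out; when it is carried out in a run, $\alpha_j=\langle i_j,t_j\rangle$ denotes the node at which $a_j$ occurs (each response occurs at most once in a run). Tightly Timed Response. An instance $\langle e_{\mathsf s},\boldsymbol{\alpha_1}:\delta_1,\dots,\boldsymbol{\alpha_k}:\delta_k\rangle$ consists of an external input (nondeterministic) event $e_{\mathsf s}$ (the trigger), responses $\boldsymbol{\alpha_1},\dots,\boldsymbol{\alpha_k}$, and integers $\delta_1,\dots,\delta_k$.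 It is solved in $\mathcal R$ if in every run of $\mathcal R$: (a) each response $\boldsymbol{\alpha_j}$, $j=1,\dots,k$, occurs in the run iff the trigger $e_{\mathsf s}$ occurs in the run; and (b) when the responses occur, their times satisfy $t_j-t_g=\delta_j-\delta_g$ for all $j,g\le k$. *)

(* Defs.v *)
From mathcomp Require Import all_boot ssralg ssrint.

Set Implicit Arguments.
Unset Strict Implicit.
Unset Printing Implicit Defensive.

Definition node (n : nat) : Type := ('I_n * nat)%type.

(* Local states are perfect-recall histories: [Step l x ms] extends the history
   [l] by one time unit, in which the external inputs [x] and the messages [ms]
   (pairs sender, content) are received; a message content is itself a local
   state.  The number of [Step]s is the timestamp: the local state at time [t]
   has [t + 1] of them, one for each of the times 0, ..., t.  [S] is the type of
   initial states and [E] the type of external input events. *)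
Inductive lstate (n : nat) (S E : Type) : Type :=
| Init of S
| Step of lstate n S E & pred E & seq ('I_n * lstate n S E).

(* Network, external events and full-information protocol.  [protocol i l] is
   the set of local actions (beyond the sending of messages) that agent [i]
   performs when its local state is [l]; nothing is assumed about it. *)
Record model (n : nat) := Model {
  channel : rel 'I_n;
  maxd : 'I_n -> 'I_n -> nat;
  maxd_gt0 : forall i j, channel i j -> 0 < maxd i j;
  event : Type;
  site : event -> 'I_n;
  action : Type;
  initial : Type;
  init : 'I_n -> initial;
  protocol : 'I_n -> lstate n initial event -> pred action
}.

(* The first two components, the environment's part of the state at time [t],
   are its choices at [t]: [inputs e] says that the external event [e] occurs
   at [t] (at the node of agent [site e]), and [delivers i j s] that the message
   sent at node (i, s) on channel (i, j) is delivered to [j] at [t]. *)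
Record gstate (n : nat) (M : model n) := GState {
  inputs : pred (event M);
  delivers : 'I_n -> 'I_n -> nat -> bool;
  local : 'I_n -> lstate n (initial M) (event M)
}.

Definition run (n : nat) (M : model n) : Type := nat -> gstate M.

Section Runs.
Context (n : nat) (M : model n).
Implicit Types (r : run M) (e : event M) (i j : 'I_n) (s t : nat).

Definition input_at r i t : pred (event M) :=
  fun e => (site e == i) && inputs (r t) e.

(* Listed in the canonical order (by sender, then by sending time), so that the
   list carries no more information than the set of messages received. *)
Definition received r j t : seq ('I_n * lstate n (initial M) (event M)) :=
  flatten [seq [seq (i, local (r s) i) | s <- iota 0 t & delivers (r t) i j s]
          | i <- enum 'I_n].

Definition previous r i t : lstate n (initial M) (event M) :=
  if t is t'.+1 then local (r t') i else Init n (event M) (init M i).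

Definition full_information r : Prop :=
  forall i t, local (r t) i =
    Step (previous r i t) (input_at r i t) (received r i t).

Definition inputs_once r : Prop :=
  forall e t t', inputs (r t) e -> inputs (r t') e -> t = t'.

Definition bounded_delivery r : Prop :=
  (forall i j s t, delivers (r t) i j s ->
     channel M i j /\ s < t <= s + maxd M i j) /\
  (forall i j s, channel M i j -> exists! t, delivers (r t) i j s).

Definition system r : Prop :=
  [/\ inputs_once r, bounded_delivery r & full_information r].

Definition occurs r e : Prop := exists t, inputs (r t) e.

Definition formula : Type := run M -> Prop.

Definition occurred t e : formula :=
  fun r => exists2 t', t' <= t & inputs (r t') e.

Definition K (a : node n) (phi : formula) : formula :=
  fun r => forall r', system r' ->
    local (r a.2) a.1 = local (r' a.2) a.1 -> phi r'.

Definition everyone (A : {pred node n}) (phi : formula) : formula :=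
  fun r => forall a, a \in A -> K a phi r.

Definition common (A : {pred node n}) (phi : formula) : formula :=
  fun r => forall m, 1 <= m -> iter m (everyone A) phi r.

Definition response : Type := ('I_n * action M)%type.

Definition response_at r (rho : response) t : Prop :=
  protocol rho.1 (local (r t) rho.1) rho.2.

Definition response_once (rho : response) : Prop :=
  forall r, system r -> forall t t',
    response_at r rho t -> response_at r rho t' -> t = t'.

End Runs.

Record ttr (n : nat) (M : model n) (k : nat) := TTR {
  trigger : event M;
  resp : 'I_k -> response M;
  delta : 'I_k -> int
}.

Definition solved (n : nat) (M : model n) (k : nat) (P : ttr M k) : Prop :=
  forall r : run M, system r ->
    (forall j, (exists t, response_at r (resp P j) t) <-> occurs r (trigger P))
    /\
    (forall j g (tj tg : nat),
       response_at r (resp P j) tj -> response_at r (resp P g) tg ->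
       (tj%:Z - tg%:Z = delta P j - delta P g)%R).

(* Main.v *)
Require Import Defs.
From mathcomp Require Import all_boot ssralg ssrint.

(** That every response [j] is carried out at its time [t j] is a public event
    for the nodes of [A]: the state at one of these nodes makes its response
    occur there, hence the trigger occurs, hence so do all the other responses,
    at times fixed by the differences of the [delta]s.  It remains to see that
    the trigger has then occurred by time [t h].  Silence all external inputs
    after [t h], keeping the delivery choices: nothing changes up to time [t h],
    so the response [h] is still carried out, so the trigger still occurs, and
    it can only do so at a time that was not silenced. *)

Set Implicit Arguments.
Unset Strict Implicit.
Unset Printing Implicit Defensive.

Section Runs.
Context (n : nat) (M : model n).
Implicit Types (r : run M) (i j : 'I_n) (s t : nat).

Lemma eq_previous r r' t i :
  (forall s, s < t -> forall j, local (r s) j = local (r' s) j) ->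
  previous r i t = previous r' i t.
Proof. by case: t => //= t eq_loc; apply: eq_loc. Qed.

Lemma eq_received r r' t j :
  delivers (r t) = delivers (r' t) ->
  (forall s, s < t -> forall i, local (r s) i = local (r' s) i) ->
  received r j t = received r' j t.
Proof.
move=> eq_del eq_loc; rewrite /received eq_del.
congr flatten; apply: eq_map => i; apply/eq_in_map => s.
by rewrite mem_filter mem_iota => /and3P[_ _ lt_st]; rewrite eq_loc.
Qed.

(** Strong induction on time: beyond the environment's choices at [t], the state at [t] depends only
    on states at strictly earlier times, since [received] ranges over [iota 0 t]. *)
Lemma eq_local r r' T :
  full_information r -> full_information r' ->
  (forall t, t <= T -> inputs (r t) = inputs (r' t)) ->
  (forall t, t <= T -> delivers (r t) = delivers (r' t)) ->
  forall t, t <= T -> forall i, local (r t) i = local (r' t) i.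
Proof.
move=> fi fi' eq_in eq_del; elim/ltn_ind => t IHt le_tT i.
have eq_loc s : s < t -> forall j, local (r s) j = local (r' s) j.
  by move=> lt_st; apply: IHt => //; apply: leq_trans (ltnW lt_st) le_tT.
rewrite fi fi' (eq_previous i eq_loc) (eq_received i (eq_del t le_tT) eq_loc).
by rewrite /input_at (eq_in t le_tT).
Qed.

Section Execution.
Context (inp : nat -> pred (event M)) (del : nat -> 'I_n -> 'I_n -> nat -> bool).

(* The full-information run for the environment [inp], [del], correct only at
   times [s < m]: a step of the protocol depends on the whole past. *)
Fixpoint execution_before (m : nat) : run M :=
  if m is m'.+1 then
    let r := execution_before m' in
    fun s => if s < m' then r s else
      GState (inp s) (del s)
        (fun i => Step (previous r i s) (input_at r i s) (received r i s))
  else fun s => GState (inp s) (del s) (fun i => Init n (event M) (init M i)).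

(** The diagonal: stage [t.+1] is the first that is correct at time [t], and later stages leave that
    value unchanged. *)
Definition execution : run M := fun t => execution_before t.+1 t.

Lemma execution_beforeE m s : s < m -> execution_before m s = execution s.
Proof.
elim: m => // m IHm; rewrite ltnS leq_eqVlt => /predU1P[-> // | lt_sm] /=.
by rewrite lt_sm IHm.
Qed.

(** This holds even for [t >= m], as is needed: the state at time [t] is computed from the inputs
    and deliveries that stage [t] shows at [t], where its local states are not yet correct. *)
Lemma inputs_execution_before m t : inputs (execution_before m t) = inp t.
Proof. by elim: m => //= m IHm; case: ifP. Qed.

Lemma delivers_execution_before m t : delivers (execution_before m t) = del t.
Proof. by elim: m => //= m IHm; case: ifP. Qed.

Lemma inputs_execution t : inputs (execution t) = inp t.
Proof. exact: inputs_execution_before. Qed.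

Lemma delivers_execution t : delivers (execution t) = del t.
Proof. exact: delivers_execution_before. Qed.

Lemma full_information_execution : full_information execution.
Proof.
move=> i t.
have eq_loc s : s < t -> forall j,
    local (execution_before t s) j = local (execution s) j.
  by move=> lt_st j; rewrite execution_beforeE.
have eq_del : delivers (execution_before t t) = delivers (execution t).
  by rewrite delivers_execution_before delivers_execution.
rewrite {1}/execution /= ltnn /= (eq_previous i eq_loc).
rewrite (eq_received i eq_del eq_loc) /input_at.
by rewrite inputs_execution_before inputs_execution.
Qed.

End Execution.

Definition silence_after T r : run M :=
  execution (fun t => if t <= T then inputs (r t) else pred0)
            (fun t => delivers (r t)).

Lemma inputs_silence_after T r t :
  inputs (silence_after T r t) = if t <= T then inputs (r t) else pred0.
Proof. exact: inputs_execution. Qed.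

Lemma delivers_silence_after T r t :
  delivers (silence_after T r t) = delivers (r t).
Proof. exact: delivers_execution. Qed.

Lemma system_silence_after T r : system r -> system (silence_after T r).
Proof.
case=> once [bnd deliv] _; split; last exact: full_information_execution.
- move=> e t t'; rewrite !inputs_silence_after.
  by case: ifP => // _ in_e; case: ifP => // _; apply: once in_e.
- split=> [i j s t | i j s ch]; first by rewrite delivers_silence_after; apply: bnd.
  have [t [del_t uniq_t]] := deliv i j s ch; exists t.
  by split=> [|t']; rewrite delivers_silence_after //; apply: uniq_t.
Qed.

Lemma local_silence_after T r t i :
  system r -> t <= T -> local (silence_after T r t) i = local (r t) i.
Proof.
move=> sys_r le_tT; have [_ _ fi'] := system_silence_after T sys_r.
case: sys_r => _ _ fi; apply: (eq_local fi' fi _ _ le_tT) => s le_sT.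
  by rewrite inputs_silence_after le_sT.
exact: delivers_silence_after.
Qed.

(** The induction rule for common knowledge. The induction starts at depth 0, where [iter] gives
    [phi] itself, and keeps the run general because each [K] passes to another run. *)
Lemma common_of_invariant (A : {pred node n}) (psi phi : formula M) r :
  (forall r', system r' -> psi r' -> phi r') ->
  (forall r', system r' -> psi r' -> everyone A psi r') ->
  system r -> psi r -> common A phi r.
Proof.
move=> psi_phi psiE sys_r psi_r m _.
elim: m r sys_r psi_r => [|m IHm] r sys_r psi_r; first exact: psi_phi.
by move=> a Aa r' sys_r' eq_a; apply: IHm => //; apply: (psiE r sys_r psi_r a).
Qed.

End Runs.

Section TightlyTimedResponse.
Context (n : nat) (M : model n) (k : nat) (P : ttr M k) (solvedP : solved P).

Lemma trigger_occurred_by_response (r : run M) j t :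
  system r -> response_at r (resp P j) t -> occurred t (trigger P) r.
Proof.
move=> sys_r resp_j.
have [/(_ j)[trig _] _] := solvedP (system_silence_after t sys_r).
have [|t'] := trig; first by exists t; rewrite /response_at local_silence_after.
by rewrite inputs_silence_after; case: ifP => // le_t't; exists t'.
Qed.

Lemma responses_determined_by_one (r r' : run M) (t : 'I_k -> nat) j :
  system r -> system r' -> (forall g, response_at r (resp P g) (t g)) ->
  response_at r' (resp P j) (t j) ->
  forall g, response_at r' (resp P g) (t g).
Proof.
move=> sys_r sys_r' resp_r resp_j g.
have [occ' time'] := solvedP sys_r'; have [_ time] := solvedP sys_r.
have [t' resp_g] : exists t', response_at r' (resp P g) t'.
  by apply/(occ' g).2/(occ' j).1; exists (t j).
(* Both runs have the same difference of [delta]s and share [t j], so cancelling it in [int] leaves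
   [t' = t g]. *)
have := time' _ _ _ _ resp_j resp_g; rewrite -(time _ _ _ _ (resp_r j) (resp_r g)).
by move/GRing.addrI/GRing.oppr_inj => [<-].
Qed.

End TightlyTimedResponse.

Theorem theorem8 (n : nat) (M : model n) (k : nat) (P : ttr M k)
    (r : run M) (t : 'I_k -> nat) (h : 'I_k) :
  (forall j, response_once (resp P j)) ->
  solved P ->
  system r ->
  occurs r (trigger P) ->
  (forall j, response_at r (resp P j) (t j)) ->
  (forall j, t h <= t j) ->
  common [in codom (fun j => ((resp P j).1, t j))] (occurred (t h) (trigger P)) r.
Proof.
move=> _ solvedP sys_r _ resp_r _.
(* From here on [r] is any run satisfying the invariant, while the times [t] remain those of the
   original run. *)
apply: (common_of_invariant (psi := fun r' =>
  forall j, response_at r' (resp P j) (t j))) => // {sys_r resp_r}r sys_r resp_r.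
  exact: trigger_occurred_by_response (resp_r h).
move=> _ /codomP[j ->] r' sys_r' /= eq_loc.
apply: (responses_determined_by_one solvedP (j := j) sys_r) => //.
by rewrite /response_at -eq_loc; apply: resp_r.
Qed.
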